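(* Let $p\in(0,1)$ and $C_{\mathrm{ar}}\ge 1$ be constants. Let $G\sim G(n_A,n_B,p)$, where $n_A,n_B$ are positive integers with $\max(n_A,n_B)\le C_{\mathrm{ar}}\cdot\min(n_A,n_B)$. Then \[ \chi'_s(G)\le \Delta_A(G)\cdot\Delta_B(G) \] asymptotically almost surely as $\min(n_A,n_B)\to\infty$; that is, the probability of this event tends to $1$ as $\min(n_A,n_B)\to\infty$ subject to $\max(n_A,n_B)\le C_{\mathrm{ar}}\min(n_A,n_B)$.
   Context: $G(n_A,n_B,p)$ is the random bipartite graph with fixed disjoint parts $A,B$ of sizes $|A|=n_A$, $|B|=n_B$, in which each of the $n_An_B$ pairs $ab$ with $a\in A$, $b\in B$ is an edge independently with probability $p$. The side maximum degrees are $\Delta_A(G)=\max_{a\in A}\deg_G(a)$ and $\Delta_B(G)=\max_{b\in B}\deg_G(b)$. A strong edge-colouring of a graph $G$ is an assignment of colours to $E(G)$ such that any two distinct edges that share a vertex, or that are joined by a third edge of $G$ (i.e. some edge of $G$ has one endpoint in each of them), receive different colours. The strong chromatic index $\chi'_s(G)$ is the minimum number of colours in a strong edge-colouring of $G$. *)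

(* Defs.v *)
From mathcomp Require Import all_boot all_order all_algebra.
From mathcomp Require Import reals.

Set Implicit Arguments.
Unset Strict Implicit.
Unset Printing Implicit Defensive.

Import Order.TTheory GRing.Theory Num.Theory.
Local Open Scope ring_scope.

Section StrongEdgeColouring.
Variable V : finType.

(* A simple graph on V is given by its edge set, a set of two-element sets. *)
Implicit Type G : {set {set V}}.

Definition degree G (v : V) : nat := #|[set e in G | v \in e]|.

(* Edges have two elements, so x = y never makes [set x; y] an edge. *)
Definition edge_joined G (e f : {set V}) : bool :=
  [exists x in e, exists y in f, [set x; y] \in G].

Definition strong_conflict G (e f : {set V}) : bool :=
  (e != f) && ((e :&: f != set0) || edge_joined G e f).

(* Colourings are defined on the edges only, so that the edgeless graph
   has a colouring with the empty palette 'I_0. *)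
Definition is_strong_colouring G (k : nat)
    (c : {ffun {e : {set V} | e \in G} -> 'I_k}) : bool :=
  [forall e, forall f, strong_conflict G (val e) (val f) ==> (c e != c f)].

Definition strong_colourable G (k : nat) : bool :=
  [exists c : {ffun {e : {set V} | e \in G} -> 'I_k}, is_strong_colouring c].

Lemma strong_colourable_ex G : exists k, strong_colourable G k.
Proof.
exists #|{: {e : {set V} | e \in G}}|; apply/existsP.
exists [ffun e => enum_rank e]; apply/forallP => e; apply/forallP => f.
apply/implyP => /andP[nef _]; rewrite !ffunE.
by apply: contra nef => /eqP/enum_rank_inj ->.
Qed.

Definition strong_chromatic_index G : nat := ex_minn (strong_colourable_ex G).

End StrongEdgeColouring.

Section RandomBipartiteGraph.
Variables nA nB : nat.

(* The parts are A = 'I_nA and B = 'I_nB, made disjoint in 'I_nA + 'I_nB;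
   S is the set of pairs ab that are edges. *)
Implicit Type S : {set 'I_nA * 'I_nB}.

Definition bipartite_graph S : {set {set 'I_nA + 'I_nB}} :=
  [set [set inl ab.1; inr ab.2] | ab in S].

Definition Delta_A (G : {set {set 'I_nA + 'I_nB}}) : nat :=
  \max_(a < nA) degree G (inl a).

Definition Delta_B (G : {set {set 'I_nA + 'I_nB}}) : nat :=
  \max_(b < nB) degree G (inr b).

Variables (R : realType) (p : R).

(* The product Bernoulli(p) mass of S: the pairs are edges independently. *)
Definition bip_mass S : R :=
  \prod_(ab : 'I_nA * 'I_nB) (if ab \in S then p else 1 - p).

Lemma bip_mass_sum1 : \sum_S bip_mass S = 1.
Proof.
rewrite /bip_mass -(bigA_distr _ _ (fun=> p) (fun=> 1 - p)).
by rewrite big1 => [|ab _] /=; last rewrite addrCA subrr addr0.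
Qed.

(* Probability that G(nA, nB, p) satisfies Q. *)
Definition bip_prob (Q : pred {set {set 'I_nA + 'I_nB}}) : R :=
  \sum_(S | Q (bipartite_graph S)) bip_mass S.

End RandomBipartiteGraph.

(* Main.v *)
(* Write N = nA nB.  The sum over pairs a, a' of the squared deviation of
   their codegree has mean at most N (nA + nB), so by Markov's inequality it is
   o(N^2) with high probability, and two applications of Cauchy-Schwarz bound
   by o(N) the deviation of the edge count from its mean in every rectangle
   X * Y.  Consequently, in every dense set F of edges, an average edge is
   compatible with a fraction close to (1 - p)^2 of F; iterating, F contains an
   induced matching of any fixed size k.  Removing such matchings greedily and
   giving the few remaining edges one colour each uses at most e / k + eps N
   colours, where e is the number of edges, about p N.  For k >= 4 / p this is
   below e^2 / N, and e <= nA Delta_A and e <= nB Delta_B. *)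

Require Import Defs.
From mathcomp Require Import all_boot all_order all_algebra.
From mathcomp Require Import reals.
From mathcomp Require Import ring lra.

Import Order.TTheory GRing.Theory Num.Theory.
Local Open Scope ring_scope.

Set Implicit Arguments.
Unset Strict Implicit.
Unset Printing Implicit Defensive.

(** * Cauchy-Schwarz, centred codegrees and cuts *)

Lemma sum_sqr_le (R : realFieldType) (I : finType) (P : pred I) (x : I -> R) :
  (\sum_(i | P i) x i) ^+ 2 <= #|I|%:R * \sum_(i | P i) x i ^+ 2.
Proof.
pose y i := if P i then x i else 0.
have -> : \sum_(i | P i) x i = \sum_i y i by rewrite big_mkcond.
have -> : \sum_(i | P i) x i ^+ 2 = \sum_i y i ^+ 2.
  by rewrite big_mkcond; apply: eq_bigr => i _; rewrite /y; case: (P i); rewrite ?expr0n.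
(* Expanding this nonnegative double sum gives Cauchy-Schwarz against the constant function. *)
have H : 0 <= \sum_i \sum_j (y i - y j) ^+ 2.
  by apply: sumr_ge0 => i _; apply: sumr_ge0 => j _; apply: sqr_ge0.
have E : \sum_i \sum_j (y i - y j) ^+ 2
    = 2 * (#|I|%:R * \sum_i y i ^+ 2) - 2 * (\sum_i y i) ^+ 2.
  transitivity (\sum_i (#|I|%:R * y i ^+ 2 + \sum_j y j ^+ 2
                        - 2 * (y i * \sum_j y j))).
    apply: eq_bigr => i _; rewrite mulr_sumr mulr_sumr mulr_natl -sumr_const.
    by rewrite -big_split -sumrB; apply: eq_bigr => j _ /=; ring.
  rewrite sumrB big_split /= -!mulr_sumr -mulr_suml sumr_const -mulr_natl.
  by ring.
by move: H; rewrite E; lra.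
Qed.

Section Deviation.
Variables (R : realFieldType) (p : R) (A B : finType).
Implicit Types (S F : {set A * B}).

Definition dev S (x : A * B) : R := (x \in S)%:R - p.

(** Expanding the square gives the sum of products of four deviations round all closed walks [a],
    [b], [a'], [b'], degenerate ones included. *)
Definition codev S : R :=
  \sum_a \sum_a' (\sum_b dev S (a, b) * dev S (a', b)) ^+ 2.

(** A bound on the cut norm of the matrix [dev S], relative to its number of entries. *)
Definition cut_small (delta : R) S := forall (X : pred A) (Y : pred B),
  `|\sum_(a | X a) \sum_(b | Y b) dev S (a, b)| <= delta * (#|A| * #|B|)%:R.

Lemma cut_pow4_le S (X : pred A) (Y : pred B) :
  (\sum_(a | X a) \sum_(b | Y b) dev S (a, b)) ^+ 4
    <= (#|A| * #|B|)%:R ^+ 2 * codev S.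
Proof.
set c := \sum_(a | X a) _.
pose D a a' := \sum_b dev S (a, b) * dev S (a', b).
pose T := \sum_(a | X a) \sum_(a' | X a') D a a'.
(* Cauchy-Schwarz over [b]; the terms are now squares, so [Y] can be enlarged to all of [B]. *)
have c2 : c ^+ 2 <= #|B|%:R * T.
  rewrite /c exchange_big /=; apply: le_trans (sum_sqr_le _ _) _.
  apply: ler_wpM2l => //.
  have -> : T = \sum_b (\sum_(a | X a) dev S (a, b)) ^+ 2.
    rewrite /T /D; under eq_bigr do rewrite exchange_big /=.
    rewrite exchange_big; apply: eq_bigr => b _ /=; rewrite expr2 mulr_suml.
    by apply: eq_bigr => a _; rewrite mulr_sumr.
  by rewrite big_mkcond; apply: ler_sum => b _; case: ifP => // _; apply: sqr_ge0.
(* Cauchy-Schwarz over the pair of indices, one index at a time; [X] is enlarged to [A] in the same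
   way. *)
have T2 : T ^+ 2 <= #|A|%:R ^+ 2 * codev S.
  apply: le_trans (sum_sqr_le _ _) _; rewrite expr2 -mulrA; apply: ler_wpM2l => //.
  rewrite /codev mulr_sumr big_mkcond; apply: ler_sum => a _; case: ifP => _.
    apply: le_trans (sum_sqr_le _ _) _; apply: ler_wpM2l => //.
    rewrite big_mkcond; apply: ler_sum => a' _.
    by case: ifP => // _; apply: sqr_ge0.
  by apply: mulr_ge0 => //; apply: sumr_ge0 => a' _; apply: sqr_ge0.
rewrite -[4%N]/(2 * 2)%N exprM.
apply: (le_trans (y := (#|B|%:R * T) ^+ 2)).
  rewrite ler_pXn2r // ?nnegrE ?sqr_ge0 //.
  by apply: le_trans c2; apply: sqr_ge0.
have -> : (#|A| * #|B|)%:R ^+ 2 * codev S = #|B|%:R ^+ 2 * (#|A|%:R ^+ 2 * codev S).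
  by rewrite natrM; ring.
by rewrite exprMn ler_wpM2l // sqr_ge0.
Qed.

Lemma codev_cut_small (delta : R) S : 0 <= delta ->
  codev S <= delta ^+ 4 * (#|A| * #|B|)%:R ^+ 2 -> cut_small delta S.
Proof.
move=> d0 H X Y; set N := (_ * _)%:R in H *.
have N0 : 0 <= N by [].
rewrite -(@ler_pXn2r _ 4) // ?nnegrE ?mulr_ge0 //.
rewrite -normrX ger0_norm; last by rewrite -[4%N]/(2 * 2)%N exprM sqr_ge0.
apply: le_trans (cut_pow4_le _ _ _) _; rewrite exprMn.
have -> : delta ^+ 4 * N ^+ 4 = N ^+ 2 * (delta ^+ 4 * N ^+ 2) by ring.
by apply: ler_wpM2l => //; apply: sqr_ge0.
Qed.

(** * Induced matchings in dense sets of edges *)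

Definition compat S (x y : A * B) : bool :=
  ((x.1, y.2) \notin S) && ((y.1, x.2) \notin S).

(** For edges of [S], [compat] also excludes a common vertex: if [x.1 = y.1], then [(x.1, y.2)] is
    [y] itself, which lies in [S]. *)
Definition induced_matching S (M : {set A * B}) :=
  {in M &, forall x y, x != y -> compat S x y}.

Section CutSmall.
Variables (delta : R) (S : {set A * B}).
Hypotheses (p0 : 0 < p) (p1 : p < 1) (cutS : cut_small delta S).
Let N : R := (#|A| * #|B|)%:R.

(** Each error term is the deviation at one crossing pair times a bounded weight depending only on
    the other, so that [sum_dev_crossed] applies. *)
Lemma compat_indicator x y : (compat S x y)%:R =
  (1 - p) ^+ 2 - (1 - p) * dev S (y.1, x.2)
    - dev S (x.1, y.2) * ((y.1, x.2) \notin S)%:R.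
Proof.
by rewrite /compat /dev; case: (_ \in S); case: (_ \in S) => /=; ring.
Qed.

Lemma sum_pairs (F : {set A * B}) (g : A * B -> R) :
  \sum_(x in F) g x = \sum_a \sum_(b | (a, b) \in F) g (a, b).
Proof.
by rewrite pair_big_dep; apply: eq_big => [] [].
Qed.

(* Fixing the coordinates [x.1] and [y.2], on which alone the weight depends,
   leaves the sum of the deviation over a rectangle. *)
Lemma sum_dev_crossed (F : {set A * B}) (w : A * B -> R) :
  (forall x, `|w x| <= 1) ->
  `|\sum_(x in F) \sum_(y in F) dev S (y.1, x.2) * w (x.1, y.2)|
    <= delta * N ^+ 2.
Proof.
move=> w1.
have -> : \sum_(x in F) \sum_(y in F) dev S (y.1, x.2) * w (x.1, y.2) =
   \sum_a1 \sum_b2 (\sum_(a2 | (a2, b2) \in F) \sum_(b1 | (a1, b1) \in F)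
     dev S (a2, b1)) * w (a1, b2).
  rewrite sum_pairs; apply: eq_bigr => a1 _; rewrite exchange_big /= sum_pairs.
  rewrite (exchange_big_dep predT) //=; apply: eq_bigr => b2 _.
  by rewrite mulr_suml; apply: eq_bigr => a2 _; rewrite mulr_suml.
have -> : delta * N ^+ 2 = \sum_(a1 : A) \sum_(b2 : B) delta * N.
  by rewrite !sumr_const -!mulrnA -[RHS]mulr_natr /N mulnC; ring.
apply: le_trans (ler_norm_sum _ _ _) _; apply: ler_sum => a1 _.
apply: le_trans (ler_norm_sum _ _ _) _; apply: ler_sum => b2 _.
rewrite normrM; apply: le_trans (ler_piMr _ (w1 _)) _.
  exact: normr_ge0.
exact: (cutS (fun a2 => (a2, b2) \in F) (fun b1 => (a1, b1) \in F)).
Qed.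

(** By averaging: with [q = 1 - p] and [f] the size of [F], at least
    [q^2 f^2 - 2 delta N^2 >= (3/4) q^2 f^2] pairs of [F * F] are compatible, while failure for
    every [x] would allow at most [q^2 f^2 / 2]. *)
Lemma dense_compat (d : R) (F : {set A * B}) :
  0 < N -> 0 < d -> delta <= (1 - p) ^+ 2 * d ^+ 2 / 8 ->
  d * N <= #|F|%:R ->
  exists2 x, x \in F &
    (1 - p) ^+ 2 / 2 * d * N <= #|[set y in F | compat S x y]|%:R.
Proof.
move=> N0 d0 hdelta hF; set f : R := #|F|%:R in hF.
pose q : R := 1 - p; have q0 : 0 < q by rewrite subr_gt0.
have q1 : q < 1 by rewrite ltrBlDr ltrDl.
case: (pickP [pred x in F | (1 - p) ^+ 2 / 2 * d * N
    <= #|[set y in F | compat S x y]|%:R]) => [x /andP[xF hx] | none].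
  by exists x.
have up : \sum_(x in F) \sum_(y in F) (compat S x y)%:R
    <= f * (q ^+ 2 / 2 * d * N).
  rewrite /f mulr_natl -sumr_const; apply: ler_sum => x xF.
  have := none x; rewrite /= xF /= => /negbT; rewrite -ltNge => /ltW.
  apply: le_trans; rewrite -natr_sum ler_nat -sum1_card.
  rewrite (eq_bigl (fun y => (y \in F) && compat S x y)); last by move=> y; rewrite !inE.
  by rewrite big_mkcondr.
have := @sum_dev_crossed F (fun=> 1) (fun=> _).
rewrite normr1 => /(_ (fun=> lexx 1)).
have := @sum_dev_crossed F (fun x => (x \notin S)%:R) (fun x => _).
have wb x : `|(x \notin S)%:R : R| <= 1 by case: (_ \in S); rewrite /= ?normr0 ?normr1.
(* Swapping the roles of [x] and [y] gives the last term of [compat_indicator]. *)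
move=> /(_ wb); rewrite exchange_big /=.
set W := \sum_(x in F) _; set V := \sum_(x in F) _ => hW hV.
have E : \sum_(x in F) \sum_(y in F) (compat S x y)%:R
    = q ^+ 2 * f ^+ 2 - q * V - W.
  rewrite /V /W mulr_sumr /f (_ : q ^+ 2 * _ = \sum_(x in F) \sum_(y in F) q ^+ 2).
    rewrite -!sumrB; apply: eq_bigr => x _; rewrite mulr_sumr -!sumrB.
    by apply: eq_bigr => y _; rewrite compat_indicator mulr1.
  by rewrite !sumr_const -mulrnA -[RHS]mulr_natr natrM expr2.
rewrite E in up; move: hW; rewrite ler_norml => /andP[_ hW].
have qV : q * V <= delta * N ^+ 2.
  apply: le_trans (ler_norm _) _; rewrite normrM gtr0_norm //.
  by apply: le_trans hV; rewrite ler_piMl // ltW.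
have dN0 : 0 < d * N by apply: mulr_gt0.
have f0 : 0 < f by apply: lt_le_trans hF.
have sq : (d * N) ^+ 2 <= f ^+ 2 by rewrite ler_pXn2r // nnegrE ltW.
have b1 : f * (q ^+ 2 / 2 * d * N) <= q ^+ 2 / 2 * f ^+ 2.
  have -> : f * (q ^+ 2 / 2 * d * N) = q ^+ 2 / 2 * (f * (d * N)) by ring.
  by rewrite ler_wpM2l ?divr_ge0 ?sqr_ge0 // expr2 ler_wpM2l // ltW.
have b2 : delta * N ^+ 2 <= q ^+ 2 / 8 * f ^+ 2.
  apply: le_trans (ler_wpM2r (sqr_ge0 N) hdelta) _.
  rewrite -/q (_ : _ * N ^+ 2 = q ^+ 2 / 8 * (d * N) ^+ 2); last by ring.
  by rewrite ler_wpM2l // divr_ge0 ?sqr_ge0.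
have : 0 < q ^+ 2 * f ^+ 2 by rewrite mulr_gt0 ?exprn_gt0.
by move: up qV hW b1 b2; lra.
Qed.

(** Choose an edge by [dense_compat] and recurse among the edges compatible with it. Each choice
    multiplies the guaranteed density by [(1 - p)^2 / 2], and the bound on [delta] is set for the
    density after [k] choices. *)
Lemma dense_induced_matching (k : nat) (d : R) (F : {set A * B}) :
  0 < N -> 0 < d ->
  delta <= (1 - p) ^+ 2 * (((1 - p) ^+ 2 / 2) ^+ k * d) ^+ 2 / 8 ->
  F \subset S -> d * N <= #|F|%:R ->
  exists M : {set A * B}, [/\ M \subset F, #|M| = k & induced_matching S M].
Proof.
move=> N0; set r : R := (1 - p) ^+ 2 / 2.
have q0 : 0 < 1 - p by rewrite subr_gt0.
have q1 : 1 - p < 1 by rewrite ltrBlDr ltrDl.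
have r0 : 0 < r by rewrite divr_gt0 ?exprn_gt0.
have r1 : r <= 1.
  have : (1 - p) ^+ 2 <= 1 by rewrite exprn_ile1 // ltW.
  by rewrite /r; lra.
elim: k d F => [|k IHk] d F d0 hdelta FS hF.
  exists set0; split; [exact: sub0set | exact: cards0 |].
  by move=> x y; rewrite inE.
have [|x xF hx] := dense_compat N0 d0 _ hF.
  apply: le_trans hdelta _.
  rewrite ler_wpM2r ?invr_ge0 // ler_wpM2l ?sqr_ge0 //.
  rewrite ler_pXn2r ?nnegrE ?mulr_ge0 ?exprn_ge0 ?(ltW d0) ?(ltW r0) //.
  by rewrite ler_piMl ?(ltW d0) // exprn_ile1 // ltW.
set F' := [set y in F | _] in hx.
have F'F : F' \subset F by apply/subsetP => y; rewrite inE => /andP[].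
have [||M [MF' cM indM]] := IHk (r * d) F' _ _ (subset_trans F'F FS) hx.
- exact: mulr_gt0.
- by rewrite [_ * (r * d)]mulrA -exprSr.
(* An edge of [S] is not compatible with itself. *)
have xM : x \notin M.
  apply/negP => /(subsetP MF'); rewrite inE => /andP[_ /andP[]].
  by rewrite -surjective_pairing (subsetP FS).
have Mx y : y \in M -> compat S x y.
  by move=> /(subsetP MF'); rewrite inE => /andP[].
exists (x |: M); split.
- by rewrite subUset sub1set xF (subset_trans MF').
- by rewrite cardsU1 xM cM.
- move=> y z /setU1P[->|yM] /setU1P[->|zM]; first by rewrite eqxx.
  + by move=> _; apply: Mx.
  + by move=> _; rewrite /compat andbC; apply: Mx.
  + exact: indM.
Qed.

End CutSmall.
End Deviation.

(** * Greedy colouring by induced matchings *)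

Section Colouring.
Variables (R : realFieldType) (A B : finType) (S : {set A * B}).

Lemma greedy_colouring (k : nat) (t : R) :
  (0 < k)%N -> 0 <= t ->
  (forall F : {set A * B}, F \subset S -> t <= #|F|%:R ->
    exists M : {set A * B}, [/\ M \subset F, #|M| = k & induced_matching S M]) ->
  forall F : {set A * B}, F \subset S ->
  exists m (c : A * B -> nat), [/\ {in F, forall x, (c x < m)%N},
    {in F &, forall x y, x != y -> c x = c y -> compat S x y} &
    m%:R <= #|F|%:R / k%:R + t].
Proof.
move=> k0 t0 extract F; have [n] := ubnP #|F|; elim: n F => // n IHn F ltFn FS.
have [tF|Ft] := leP t #|F|%:R; last first.
  (* Below the threshold every edge gets its own colour, which costs fewer than [t] colours. *)
  exists #|F|, (fun x => index x (enum F)); split=> [x xF|x y xF yF nxy eqi|].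
  - by rewrite cardE index_mem mem_enum.
  - case/eqP: nxy; rewrite -(nth_index x (s := enum F) (x := x)) ?mem_enum //.
    by rewrite eqi nth_index ?mem_enum.
  - by rewrite (le_trans (ltW Ft)) // lerDr divr_ge0.
have [M [MF cM indM]] := extract F FS tF.
have cF : #|F| = (k + #|F :\: M|)%N.
  by rewrite -(cardsID M F) (setIidPr MF) cM.
have [||m [c [cm cc hm]]] := IHn (F :\: M).
- by rewrite -ltnS; apply: leq_trans ltFn; rewrite cF !ltnS -[X in (X < _)%N]add0n ltn_add2r.
- exact: subset_trans (subsetDl _ _) FS.
(* The matching takes the fresh colour [m]; removing its [k] edges lowers the size of [F] over [k]
   by exactly one. *)
exists m.+1, (fun x => if x \in M then m else c x); split.
- move=> x xF; case: ifP => // xM.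
  by apply: ltnW; rewrite ltnS; apply: cm; rewrite inE xM.
- move=> x y xF yF nxy; case: ifP => xM; case: ifP => yM.
  + by move=> _; apply: indM.
  + by move=> eqm; have := cm y; rewrite inE yM yF -eqm ltnn => /(_ isT).
  + by move=> eqm; have := cm x; rewrite inE xM xF eqm ltnn => /(_ isT).
  + by apply: cc; rewrite // inE ?xM ?yM.
- have k0' : (k%:R : R) != 0 by rewrite pnatr_eq0 -lt0n.
  rewrite -addn1 natrD cF natrD mulrDl divff //.
  by move: hm; lra.
Qed.

End Colouring.

(** * From pairs to graphs: strong colourings and degrees *)

Section Graph.
Variables nA nB : nat.
Implicit Type S : {set 'I_nA * 'I_nB}.

Definition edge (x : 'I_nA * 'I_nB) : {set 'I_nA + 'I_nB} := [set inl x.1; inr x.2].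

Lemma edge_inlE x a : (inl a \in edge x) = (a == x.1).
Proof. by rewrite !inE orbF. Qed.

Lemma edge_inrE x b : (inr b \in edge x) = (b == x.2).
Proof. by rewrite !inE. Qed.

Lemma edge_inj : injective edge.
Proof.
move=> [a b] [a' b'] eqe.
have /eqP -> : a == a' by rewrite -[a']/(a', b').1 -edge_inlE -eqe edge_inlE.
by have /eqP -> : b == b' by rewrite -[b']/(a', b').2 -edge_inrE -eqe edge_inrE.
Qed.

Lemma edge_mem S a b : ([set inl a; inr b] \in bipartite_graph S) = ((a, b) \in S).
Proof. exact: (mem_imset S (a, b) edge_inj). Qed.

Lemma strong_chromatic_index_le S m n (c : 'I_nA * 'I_nB -> nat) :
  {in S, forall x, (c x < m)%N} ->
  {in S &, forall x y, x != y -> c x = c y -> compat S x y} ->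
  (m <= n)%N -> (strong_chromatic_index (bipartite_graph S) <= n)%N.
Proof.
move=> cm cc mn; rewrite /strong_chromatic_index; case: ex_minnP => k _; apply.
set G := bipartite_graph S.
(* Choose for each edge of the graph the pair that it comes from, to transport the colouring. *)
have /fin_all_exists [g hg] : forall e : {e | e \in G},
    exists x, x \in S /\ val e = edge x.
  by case=> e eG; have /imsetP[x xS ex] := eG; exists x.
have gn e : (c (g e) < n)%N by apply: leq_trans mn; apply: cm; case: (hg e).
apply/existsP; exists [ffun e => Ordinal (gn e)].
apply/forallP => e; apply/forallP => f; apply/implyP.
case: (hg e) (hg f) => xS ee [yS ef]; rewrite !ffunE ee ef /strong_conflict.
move: (gn e) (gn f); set x := g e; set y := g f in yS ef * => gx gy /andP[nef conf].
apply/negP => /eqP [cxy].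
have nxy : x != y by apply: contra nef => /eqP ->.
have /andP[nS1 nS2] := cc x y xS yS nxy cxy.
(* If the edges share a vertex, one crossing pair is [x] or [y] itself, hence in [S]. *)
case/orP: conf => [/set0Pn[v]|].
  rewrite inE; case: v => v; rewrite ?edge_inlE ?edge_inrE => /andP[/eqP vx /eqP vy].
    by move: nS1; rewrite -vx vy -surjective_pairing yS.
  by move: nS1; rewrite -vy vx -surjective_pairing xS.
(* A joining edge is one of the two crossing pairs; two ends on the same side are impossible, as
   every edge meets both parts. *)
move=> /existsP[v /andP[vx /existsP[w /andP[wy]]]].
move: vx wy; case: v => v; case: w => w; rewrite ?edge_inlE ?edge_inrE => /eqP-> /eqP->.
- case/imsetP => z _ /setP /(_ (inr z.2)).
  by rewrite edge_inrE eqxx !inE.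
- by rewrite edge_mem (negbTE nS1).
- by rewrite setUC edge_mem (negbTE nS2).
- case/imsetP => z _ /setP /(_ (inl z.1)).
  by rewrite edge_inlE eqxx !inE.
Qed.

Lemma card_le_Delta_A S : (#|S| <= nA * Delta_A (bipartite_graph S))%N.
Proof.
rewrite -sum1_card (partition_big (fun x => x.1) predT) //=.
rewrite -[X in (_ <= X * _)%N]card_ord -sum_nat_const; apply: leq_sum => a _.
apply: (leq_trans _ (leq_bigmax a)); rewrite sum1dep_card -(card_imset _ edge_inj).
apply: subset_leq_card; apply/subsetP => e /imsetP[x].
rewrite inE => /andP[xS /eqP <-] ->.
by rewrite inE edge_inlE eqxx imset_f.
Qed.

Lemma card_le_Delta_B S : (#|S| <= nB * Delta_B (bipartite_graph S))%N.
Proof.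
rewrite -sum1_card (partition_big (fun x => x.2) predT) //=.
rewrite -[X in (_ <= X * _)%N]card_ord -sum_nat_const; apply: leq_sum => b _.
apply: (leq_trans _ (leq_bigmax b)); rewrite sum1dep_card -(card_imset _ edge_inj).
apply: subset_leq_card; apply/subsetP => e /imsetP[x].
rewrite inE => /andP[xS /eqP <-] ->.
by rewrite inE edge_inrE eqxx imset_f.
Qed.

End Graph.

(** * The deterministic bound for graphs with small cut deviation *)

Lemma cut_small_chromatic (R : realFieldType) (p delta : R) (nA nB k : nat)
    (S : {set 'I_nA * 'I_nB}) :
  0 < p -> p < 1 -> (0 < nA)%N -> (0 < nB)%N -> 4 <= p * k%:R ->
  delta <= p / 2 ->
  delta <= (1 - p) ^+ 2 * (((1 - p) ^+ 2 / 2) ^+ k * (p ^+ 2 / 8)) ^+ 2 / 8 ->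
  cut_small p delta S ->
  (strong_chromatic_index (bipartite_graph S)
    <= Delta_A (bipartite_graph S) * Delta_B (bipartite_graph S))%N.
Proof.
move=> p0 p1 nA0 nB0 hk hd1 hd2 cutS; pose N : R := (nA * nB)%:R.
have cN : (#|'I_nA| * #|'I_nB|)%:R = N by rewrite !card_ord.
have N0 : 0 < N by rewrite ltr0n muln_gt0 nA0.
have k0 : (0 < k)%N by case: k hk {hd2} => //; rewrite mulr0; lra.
have eps0 : 0 < p ^+ 2 / 8 by rewrite divr_gt0 ?exprn_gt0.
have extract (F : {set 'I_nA * 'I_nB}) : F \subset S -> p ^+ 2 / 8 * N <= #|F|%:R ->
    exists M : {set _}, [/\ M \subset F, #|M| = k & induced_matching S M].
  by move=> FS hF; apply: dense_induced_matching eps0 hd2 FS _; rewrite ?cN.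
have t0 : 0 <= p ^+ 2 / 8 * N by rewrite mulr_ge0 // ltW.
have [m [c [cm cc hm]]] := greedy_colouring k0 t0 extract (subxx S).
apply: strong_chromatic_index_le cm cc _.
set DA := Delta_A _; set DB := Delta_B _; set e : R := #|S|%:R in hm.
(* The cut bound for the full rectangle controls the number of edges. *)
have he : p / 2 * N <= e.
  have := cutS predT predT; rewrite cN.
  have -> : \sum_(a | predT a) \sum_(b | predT b) dev p S (a, b) = e - p * N.
    rewrite pair_bigA /= /dev sumrB sumr_const card_prod !card_ord -mulr_natr.
    congr (_ - _); rewrite /e -sum1_card natr_sum [RHS]big_mkcond /=.
    by apply: eq_bigr => -[a b] _ /=; case: (_ \in S).
  rewrite ler_norml => /andP[h _].
  have := ler_wpM2r (ltW N0) hd1; lra.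
have e2 : e ^+ 2 <= N * (DA * DB)%:R.
  rewrite /e /N -natrX -natrM ler_nat mulnACA -mulnn.
  by apply: leq_mul; [exact: card_le_Delta_A | exact: card_le_Delta_B].
have hek : e / k%:R <= p / 4 * e.
  rewrite ler_pdivrMr ?ltr0n //.
  have := ler_wpM2r (ler0n R #|S|) hk; rewrite -/e; lra.
have e0 : 0 <= e by rewrite ler0n.
(* Half of [p / 2 * N * e] pays for the matchings, at most [p / 4 * e] colours; by [he] the other
   half pays for the [p ^+ 2 / 8 * N] leftover colours. *)
have h1 : p / 2 * N * e <= e ^+ 2 by rewrite expr2 ler_wpM2r.
have h2 : p / 4 * N * (p / 2 * N) <= p / 4 * N * e.
  by rewrite ler_wpM2l // mulr_ge0 ?(ltW N0) // divr_ge0 // ltW.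
have h3 : N * m%:R <= N * (p / 4 * e + p ^+ 2 / 8 * N).
  by rewrite ler_pM2l //; apply: le_trans hm _; lra.
rewrite -(ler_nat R) -(ler_pM2l N0).
apply: le_trans h3 (le_trans _ e2); move: h1 h2; lra.
Qed.

(** * The expected codegree deviation *)

Section Expectation.
Variables (R : realType) (p : R) (nA nB : nat).
Hypotheses (p0 : 0 < p) (p1 : p < 1).
Implicit Types (S : {set 'I_nA * 'I_nB}) (x : 'I_nA * 'I_nB).

Lemma bip_mass_ge0 S : 0 <= bip_mass p S.
Proof.
by apply: prodr_ge0 => x _; case: ifP => _; rewrite ?subr_ge0 ltW.
Qed.

Lemma normr_dev_le1 S x : `|dev p S x| <= 1.
Proof.
by rewrite ler_norml /dev; case: (_ \in S) => /=; apply/andP; split;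
   move: p0 p1; lra.
Qed.

(** By independence the factor at [x] splits off, and its mean is
    [p (1 - p) + (1 - p) (- p) = 0]. *)
Lemma expect_dev_eq0 x (s : seq ('I_nA * 'I_nB)) : x \notin s ->
  \sum_(S : {set 'I_nA * 'I_nB}) bip_mass p S * (dev p S x * \prod_(y <- s) dev p S y) = 0.
Proof.
(* [h b z] collects all factors belonging to the pair [z] when its membership is [b]; repetitions in
   [s] are allowed. The expectation then factors over pairs. *)
move=> xs; pose h (b : bool) z : R :=
  \prod_(y <- x :: s) (if z == y then b%:R - p else 1).
transitivity (\sum_(S : {set 'I_nA * 'I_nB}) \prod_z (if z \in S then p * h true z else (1 - p) * h false z)).
  apply: eq_bigr => S _; rewrite /bip_mass.
  have -> : dev p S x * \prod_(y <- s) dev p S y = \prod_z h (z \in S) z.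
    transitivity (\prod_(y <- x :: s) dev p S y); first by rewrite big_cons.
    rewrite /h exchange_big /=; apply: eq_bigr => y _.
    by rewrite -big_mkcond big_pred1_eq.
  by rewrite -big_split; apply: eq_bigr => z _ /=; case: (z \in S).
have hx b : h b x = b%:R - p.
  rewrite /h big_cons eqxx big1_seq ?mulr1 // => y /andP[_ ys].
  by case: eqP ys => // <- ys; rewrite ys in xs.
rewrite -bigA_distr (bigD1 x) //= !hx (_ : p * _ + _ * _ = 0) ?mul0r //=.
by ring.
Qed.

(** On a genuine rectangle [(a, b)] differs from the other three corners and the mean vanishes; on a
    degenerate one the product is at most 1. *)
Lemma expect_dev_rect_le a a' b b' :
  \sum_(S : {set 'I_nA * 'I_nB}) bip_mass p S *
      (dev p S (a, b) * (dev p S (a', b) * (dev p S (a, b') * dev p S (a', b'))))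
    <= (a == a')%:R + (b == b')%:R.
Proof.
have [ab | /norP[na nb]] := boolP ((a == a') || (b == b')).
  apply: (@le_trans _ _ 1); last first.
    by rewrite -natrD ler1n; move: ab; case: (a == a'); case: (b == b').
  rewrite -(bip_mass_sum1 nA nB p); apply: ler_sum => S _.
  rewrite ler_piMr ?bip_mass_ge0 //; apply: le_trans (ler_norm _) _.
  by rewrite !normrM !mulr_ile1 ?mulr_ge0 ?normr_ge0 ?normr_dev_le1.
have := @expect_dev_eq0 (a, b) [:: (a', b); (a, b'); (a', b')].
rewrite !inE !xpair_eqE (negbTE na) (negbTE nb) /= andbF => /(_ isT).
under eq_bigr do rewrite !big_cons big_nil mulr1.
by move=> ->; rewrite addr0.
Qed.

(** The bound counts degenerate rectangles: [nA nB^2] with [a = a'] and [nA^2 nB] with [b = b']. *)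
Lemma expect_codev_le :
  \sum_(S : {set 'I_nA * 'I_nB}) bip_mass p S * codev p S <= (nA * nB)%:R * (nA + nB)%:R.
Proof.
pose X S a a' b b' : R :=
  dev p S (a, b) * (dev p S (a', b) * (dev p S (a, b') * dev p S (a', b'))).
have -> : \sum_(S : {set 'I_nA * 'I_nB}) bip_mass p S * codev p S =
    \sum_a \sum_a' \sum_b \sum_b' \sum_(S : {set 'I_nA * 'I_nB}) bip_mass p S * X S a a' b b'.
  transitivity (\sum_(S : {set 'I_nA * 'I_nB}) \sum_a \sum_a' \sum_b \sum_b' bip_mass p S * X S a a' b b').
    apply: eq_bigr => S _; rewrite mulr_sumr; apply: eq_bigr => a _.
    rewrite mulr_sumr; apply: eq_bigr => a' _; rewrite expr2 mulr_suml mulr_sumr.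
    apply: eq_bigr => b _; rewrite mulr_sumr mulr_sumr.
    by apply: eq_bigr => b' _; rewrite /X; ring.
  rewrite exchange_big; apply: eq_bigr => a _.
  rewrite exchange_big; apply: eq_bigr => a' _.
  rewrite exchange_big; apply: eq_bigr => b _.
  by rewrite exchange_big.
apply: (@le_trans _ _ (\sum_(a < nA) \sum_(a' < nA) \sum_(b < nB) \sum_(b' < nB)
    ((a == a')%:R + (b == b')%:R))).
  by do 4! apply: ler_sum => ? _; apply: expect_dev_rect_le.
have sum_delta n (i : 'I_n) : \sum_(j < n) (i == j)%:R = 1 :> R.
  rewrite (bigD1 i) //= eqxx big1 ?addr0 // => j; rewrite eq_sym.
  by move=> /negbTE ->.
have inner a a' : \sum_(b < nB) \sum_(b' < nB) ((a == a')%:R + (b == b')%:R)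
    = nB%:R ^+ 2 * (a == a' :> 'I_nA)%:R + nB%:R :> R.
  under eq_bigr do rewrite big_split /= sum_delta sumr_const card_ord -mulr_natl.
  by rewrite sumr_const card_ord -mulr_natl; ring.
under eq_bigr => a _.
  under eq_bigr do rewrite inner.
  rewrite big_split /= -mulr_sumr sum_delta sumr_const card_ord -mulr_natl; over.
by rewrite sumr_const card_ord -mulr_natl natrM natrD; lra.
Qed.

(* Markov's inequality for [codev], whose mean is [O(nA * nB * (nA + nB))]. *)
Lemma bip_prob_cut_small (delta : R) (Q : pred {set {set 'I_nA + 'I_nB}}) :
  (0 < nA)%N -> (0 < nB)%N -> 0 < delta ->
  (forall S, cut_small p delta S -> Q (bipartite_graph S)) ->
  `|bip_prob p Q - 1| <= (nA + nB)%:R / (delta ^+ 4 * (nA * nB)%:R).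
Proof.
move=> nA0 nB0 d0 hQ; set N : R := (nA * nB)%:R.
have N0 : 0 < N by rewrite ltr0n muln_gt0 nA0.
pose q : R := \sum_(S | ~~ Q (bipartite_graph S)) bip_mass p S.
have -> : bip_prob p Q = 1 - q.
  by rewrite -(bip_mass_sum1 nA nB p) (bigID (fun S => Q (bipartite_graph S))) /= addrK.
have q0 : 0 <= q by apply: sumr_ge0 => S _; apply: bip_mass_ge0.
rewrite addrAC subrr add0r normrN ger0_norm // ler_pdivlMr; last first.
  by rewrite mulr_gt0 ?exprn_gt0.
rewrite -(ler_pM2r N0).
have -> : q * (delta ^+ 4 * N) * N = q * (delta ^+ 4 * N ^+ 2) by ring.
apply: (@le_trans _ _ (\sum_(S : {set 'I_nA * 'I_nB}) bip_mass p S * codev p S)); last first.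
  by apply: le_trans expect_codev_le _; rewrite mulrC.
rewrite /q mulr_suml big_mkcond; apply: ler_sum => S _.
case: ifPn => [nQ | _]; last first.
  apply: mulr_ge0; first exact: bip_mass_ge0.
  by do 2! apply: sumr_ge0 => ? _; apply: sqr_ge0.
(* Where [Q] fails, [codev] is at least [delta ^+ 4 * N ^+ 2], by contraposition. *)
rewrite ler_wpM2l ?bip_mass_ge0 // leNgt; apply: contra nQ => /ltW hS.
by apply: hQ; apply: codev_cut_small (ltW d0) _; rewrite !card_ord.
Qed.

End Expectation.

(** * Choice of constants and the limit *)

Theorem theorem1p4 (R : realType) (p Car : R) (hp0 : 0 < p) (hp1 : p < 1)
    (hCar : 1 <= Car) :
  forall eps : R, 0 < eps ->
  exists N : nat, forall nA nB : nat,
    (0 < nA)%N -> (0 < nB)%N ->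
    (N <= minn nA nB)%N ->
    (maxn nA nB)%:R <= Car * (minn nA nB)%:R ->
    `| bip_prob p (fun G : {set {set 'I_nA + 'I_nB}} =>
         (strong_chromatic_index G <= Delta_A G * Delta_B G)%N) - 1 | < eps.
Proof.
move=> eps eps0.
pose k := Num.bound (4 / p).
have hk : 4 <= p * k%:R.
  by rewrite mulrC -ler_pdivrMr // ltW // archi_boundP // divr_ge0 // ltW.
have q0 : 0 < 1 - p by rewrite subr_gt0.
pose d2 : R := (1 - p) ^+ 2 * (((1 - p) ^+ 2 / 2) ^+ k * (p ^+ 2 / 8)) ^+ 2 / 8.
pose delta : R := Num.min (p / 2) d2.
have d0 : 0 < delta.
  rewrite lt_min divr_gt0 //= divr_gt0 // mulr_gt0 ?exprn_gt0 //.
  by rewrite mulr_gt0 ?exprn_gt0 ?divr_gt0 ?exprn_gt0.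
(* Since [nA + nB] is at most twice the maximum and [nA * nB] is minimum times maximum, the failure
   bound is at most [2 / (delta ^+ 4 * minn nA nB)], below [eps] once the minimum exceeds [c]. *)
pose c : R := 2 / (delta ^+ 4 * eps).
have d4 : 0 < delta ^+ 4 by rewrite exprn_gt0.
have c0 : 0 <= c by rewrite divr_ge0 // mulr_ge0 // ltW.
exists (Num.bound c) => nA nB nA0 nB0 hN _.
apply: (le_lt_trans (bip_prob_cut_small hp0 hp1 nA0 nB0 d0 _)).
  move=> S; apply: cut_small_chromatic hp0 hp1 nA0 nB0 hk _ _.
    by rewrite ge_min lexx.
  by rewrite ge_min lexx orbT.
have N0 : 0 < (nA * nB)%:R :> R by rewrite ltr0n muln_gt0 nA0.
rewrite ltr_pdivrMr ?mulr_gt0 //.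
have hc : 2 < (minn nA nB)%:R * (delta ^+ 4 * eps).
  rewrite -ltr_pdivrMr ?mulr_gt0 //; apply: lt_le_trans (archi_boundP c0) _.
  by rewrite ler_nat.
have hmax : (nA + nB)%:R <= 2 * (maxn nA nB)%:R :> R.
  by rewrite -natrM ler_nat mul2n -addnn leq_add ?leq_maxl ?leq_maxr.
apply: le_lt_trans hmax _.
have -> : eps * (delta ^+ 4 * (nA * nB)%:R)
    = (minn nA nB)%:R * (delta ^+ 4 * eps) * (maxn nA nB)%:R.
  have -> : (nA * nB = minn nA nB * maxn nA nB)%N by case: leqP; rewrite // mulnC.
  by rewrite natrM; ring.
by rewrite ltr_pM2r // ltr0n leq_max nA0.
Qed.
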